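(* Let $Q$ be a null form on $\mathbb{R}^{3+1}$. For any given positive number $E_0>0$, there exists a smooth initial data set $(\varphi^{(0)},\varphi^{(1)})$ on $\mathbb{R}^3$ for the Cauchy problem $$\Box\varphi = Q(\nabla\varphi,\nabla\varphi),\qquad (\varphi,\partial_t\varphi)|_{t=0}=(\varphi^{(0)},\varphi^{(1)}),$$ such that $$\frac12\int_{\mathbb{R}^3}|\nabla\varphi^{(0)}|^2+|\varphi^{(1)}|^2\,dx_1dx_2dx_3\ \ge\ E_0,$$ and this data set leads to a classical smooth solution $\varphi$ of the Cauchy problem. Moreover, the future life-span of the solution is $[0,\infty)$.
   Context: The unknown $\varphi$ is a real scalar function on Minkowski space $\mathbb{R}^{3+1}$ with coordinates $(t,x_1,x_2,x_3)$ (also $x_0=t$) and metric $g=-dt^2+dx_1^2+dx_2^2+dx_3^2$; $\Box=-\partial_t^2+\partial_1^2+\partial_2^2+\partial_3^2$. A null form is a real form $Q(\xi,\eta)=Q^{\alpha\beta}\xi_\alpha\eta_\beta$ with constant coefficients such that $Q(\xi,\xi)=0$ for every null vector $\xi$ (i.e. $-\xi_0^2+\xi_1^2+\xi_2^2+\xi_3^2=0$); and $Q(\nabla\phi,\nabla\psi)=Q^{\alpha\beta}\,\partial_\alpha\phi\,\partial_\beta\psi$. In the energy, $\nabla\varphi^{(0)}$ is the spatial gradient. *)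

(* Defs.v *)
From HB Require Import structures.
From mathcomp Require Import all_boot all_order all_algebra.
From mathcomp Require Import all_classical all_reals all_analysis.

Set Implicit Arguments.
Unset Strict Implicit.
Unset Printing Implicit Defensive.

Import Order.TTheory GRing.Theory Num.Theory.
Import numFieldNormedType.Exports.

Local Open Scope classical_set_scope.
Local Open Scope ring_scope.

Section Smooth.
Context {R : realType} {n : nat}.
Implicit Types (f : 'rV[R]_n -> R) (A : set 'rV[R]_n).

Definition partial (i : 'I_n) f : 'rV[R]_n -> R :=
  fun x => 'D_(delta_mx 0 i) f x.

Definition iter_partial (s : seq 'I_n) f : 'rV[R]_n -> R :=
  foldr partial f s.

(* All partial derivatives of all orders exist and are continuous on some open
   neighbourhood of A. In particular, for A closed, f is C^oo up to the
   boundary of A; its values away from A are irrelevant. *)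
Definition smooth_on A f : Prop :=
  exists U : set 'rV[R]_n,
    [/\ open U, A `<=` U &
        forall (s : seq 'I_n) (x : 'rV[R]_n), U x ->
          {for x, continuous (iter_partial s f)} /\
          forall i : 'I_n, derivable (iter_partial s f) x (delta_mx 0 i)].

End Smooth.

Section Wave.
Context {R : realType}.

(* Indices of 'rV[R]_4: 0 is the time direction, and rshift 1 i, for i : 'I_3,
   are the three spatial directions. *)
Definition time_idx : 'I_4 := ord0.
Definition space_idx (i : 'I_3) : 'I_4 := rshift 1 i.

Definition event (t : R) (x : 'rV[R]_3) : 'rV[R]_4 :=
  (row_mx t%:M x : 'rV[R]_(1 + 3)).

Definition time_slab (I : set R) : set 'rV[R]_4 := [set X | I (X 0 time_idx)].

Definition qform (Q : 'M[R]_4) (xi eta : 'rV[R]_4) : R :=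
  \sum_(a < 4) \sum_(b < 4) Q a b * xi 0 a * eta 0 b.

Definition null_vector (xi : 'rV[R]_4) : Prop :=
  - xi 0 time_idx ^+ 2 + \sum_(i < 3) xi 0 (space_idx i) ^+ 2 = 0.

(* Q need not be symmetric. *)
Definition null_form (Q : 'M[R]_4) : Prop :=
  forall xi : 'rV[R]_4, null_vector xi -> qform Q xi xi = 0.

Definition grad (phi : 'rV[R]_4 -> R) (X : 'rV[R]_4) : 'rV[R]_4 :=
  \row_a partial a phi X.

Definition box (phi : 'rV[R]_4 -> R) (X : 'rV[R]_4) : R :=
  - partial time_idx (partial time_idx phi) X
  + \sum_(i < 3) partial (space_idx i) (partial (space_idx i) phi) X.

Definition classical_solution (Q : 'M[R]_4) (phi0 phi1 : 'rV[R]_3 -> R)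
    (I : set R) (phi : 'rV[R]_4 -> R) : Prop :=
  [/\ smooth_on (time_slab I) phi,
      forall X, time_slab I X -> box phi X = qform Q (grad phi X) (grad phi X),
      forall x, phi (event 0 x) = phi0 x &
      forall x, partial time_idx phi (event 0 x) = phi1 x].

(* The library has product measures on pairs only, so Lebesgue measure on R^3
   lives on (R * R) * R and vec3 identifies this product with 'rV[R]_3. *)
Definition vec3 (p : R * R * R) : 'rV[R]_3 :=
  \row_(i < 3) [:: p.1.1; p.1.2; p.2]`_i.

Definition energy_density (phi0 phi1 : 'rV[R]_3 -> R) (x : 'rV[R]_3) : R :=
  \sum_(i < 3) partial i phi0 x ^+ 2 + phi1 x ^+ 2.

(* The energy is +oo when the integral diverges. *)
Definition energy (phi0 phi1 : 'rV[R]_3 -> R) : \bar R :=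
  ((2^-1)%:E *
   \int[(@lebesgue_measure R \x @lebesgue_measure R) \x @lebesgue_measure R]_p
     (energy_density phi0 phi1 (vec3 p))%:E)%E.

End Wave.

(* Main.v *)
Require Import Defs.
From HB Require Import structures.
From mathcomp Require Import all_boot all_order all_algebra.
From mathcomp Require Import all_classical all_reals all_analysis.
From mathcomp Require Import measurable_realfun ring lra.

Set Implicit Arguments.
Unset Strict Implicit.
Unset Printing Implicit Defensive.

Import Order.TTheory GRing.Theory Num.Theory.
Import numFieldNormedType.Exports.

Local Open Scope classical_set_scope.
Local Open Scope ring_scope.

(** On the null cone a null form vanishes together with the Minkowski form
    g(xi,xi) = -xi_0^2 + xi_1^2 + xi_2^2 + xi_3^2, which forces
    Q(xi,xi) = c g(xi,xi) for a constant c [null_form_minkowski]. The equation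
    is therefore box phi = c g(grad phi, grad phi), and for c <> 0 the
    substitution u = exp(- c phi) (Nirenberg) turns it into the linear wave
    equation: whenever u > 0 and box u = 0, the function phi = - ln u / c is a
    solution [box_log]. Large global solutions thus come from solutions of the
    linear equation that stay positive for t >= 0.

    Such a solution is explicit. Translating the fundamental solution
    1 / (r^2 - t^2) by -i in time gives the function 1 / (r^2 - (t - i)^2),
    which is regular on the whole real space-time; its imaginary part is a
    negative multiple of
      wave = t / ((r^2 - t^2 + 1)^2 + 4 t^2).
    It solves the linear equation [box_wave] and has the sign of t, so
    u = 1 + k wave is at least 1 for t >= 0 whatever the size of k >= 0. No
    smallness is needed, and k governs the energy: phi vanishes at t = 0 and
    its time derivative there is a multiple of (1 + r^2)^-2. The energy is
    quadratic in that multiple; it is finite because (1 + r^2)^4 dominates the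
    product of the 1 + x_i^2 [energy_bump_lty], and it is bounded below by the
    contribution of the unit cube [energy_bump_ge]. When c = 0 the equation is
    linear and k wave itself is a solution with data of the same form.

    All functions involved are built from coordinates by sums, products,
    inverses and logarithms. That class is closed under partial derivatives
    [elementary_partial], hence consists of smooth functions
    [elementary_smooth]. *)

(** * Directional derivatives of scalar functions *)

Section DirectionalDerivatives.
Context {R : realType} {V : normedModType R}.
Implicit Types (f g : V -> R) (x v : V).

Lemma is_derive_const (c : R) x v : is_derive x v (fun _ : V => c) 0.
Proof. exact: is_derive_cst. Qed.

(** These rules speak of pointwise expressions, so that they unify with the
   explicit formulas below and can be composed as terms. *)
Lemma is_derive_add f g x v (df dg : R) :
  is_derive x v f df -> is_derive x v g dg ->
  is_derive x v (fun y => f y + g y) (df + dg).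
Proof. by move=> hf hg; exact: is_deriveD. Qed.

Lemma is_derive_mul f g x v (df dg : R) :
  is_derive x v f df -> is_derive x v g dg ->
  is_derive x v (fun y => f y * g y) (df * g x + f x * dg).
Proof.
move=> hf hg; apply: is_derive_eq (is_deriveM hf hg) _.
by rewrite /GRing.scale /= addrC mulrC.
Qed.

Lemma is_derive_inv f x v (df : R) : f x != 0 ->
  is_derive x v f df -> is_derive x v (fun y => (f y)^-1) (- df * (f x)^-1 ^+ 2).
Proof.
move=> fx0 [hf <-]; apply: DeriveDef; first exact: derivableV.
by rewrite deriveV// exprVn /GRing.scale /= mulNr mulrC mulNr.
Qed.

(** The chain rule for one-variable functions applies because a directional
    derivative is the derivative at 0 of the restriction to a line. *)
Lemma is_derive_ln f x v (df : R) : 0 < f x ->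
  is_derive x v f df -> is_derive x v (fun y => ln (f y)) (df * (f x)^-1).
Proof.
have line (F : V -> R) : 'D_v F x = 'D_1 (fun h : R => F (h *: v + x)) 0.
  rewrite /derive; set g1 := fun h => h^-1 *: _; set g2 := fun h => h^-1 *: _.
  suff -> : g1 = g2 by [].
  by apply/funext => h; rewrite /g1 /g2 /= addr0 scale0r add0r [_%:A]mulr1.
move=> fx0 [hf dfE].
pose F (h : R) := f (h *: v + x).
have F0 : F 0 = f x by rewrite /F scale0r add0r.
have dF : is_derive (0 : R) 1 F df.
  by split; [exact: (derivable1P f x v).1 hf|by rewrite -line].
have dln : is_derive (F 0) 1 (@ln R) (F 0)^-1.
  by apply: is_derive1_ln; rewrite F0.
have [dG GE] := @is_derive1_comp _ (@ln R) F _ _ _ dln dF.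
split; first exact: (derivable1P (fun y => ln (f y)) x v).2 dG.
by rewrite line GE F0 /GRing.scale /= mulrC.
Qed.

End DirectionalDerivatives.

(** * Elementary functions are smooth *)

Section Elementary.
Context {R : realType} {n : nat}.
Implicit Types (U : set 'rV[R]_n) (f g : 'rV[R]_n -> R).

Lemma is_derive_coord (i j : 'I_n) (x : 'rV[R]_n) :
  is_derive x (delta_mx 0 i) (fun y => y 0 j) (j == i)%:R.
Proof.
apply: DeriveDef; first exact/diff_derivable/differentiable_coord.
apply: lim_near_cst => //; near=> h.
rewrite /= !mxE addrK eqxx /= /GRing.scale /= mulKf//.
by near: h; exact: nbhs_dnbhs_neq.
Unshelve. all: by end_near. Qed.

(** The side conditions are only imposed on [U]: an elementary function is
    smooth on [U] whatever the values of its subterms elsewhere. *)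
Inductive elementary U : ('rV[R]_n -> R) -> Prop :=
| elementary_cst c : elementary U (fun=> c)
| elementary_coord j : elementary U (fun x => x 0 j)
| elementary_add f g : elementary U f -> elementary U g ->
    elementary U (fun x => f x + g x)
| elementary_mul f g : elementary U f -> elementary U g ->
    elementary U (fun x => f x * g x)
| elementary_inv f : elementary U f -> (forall x, U x -> f x != 0) ->
    elementary U (fun x => (f x)^-1)
| elementary_ln f : elementary U f -> (forall x, U x -> 0 < f x) ->
    elementary U (fun x => ln (f x)).

Lemma elementary_opp U f : elementary U f -> elementary U (fun x => - f x).
Proof.
move=> hf; rewrite (_ : (fun _ => _) = (fun x => -1 * f x)).
  by apply: elementary_mul => //; exact: elementary_cst.
by apply/funext => x; rewrite mulN1r.
Qed.

Lemma elementary_exp U f k : elementary U f -> elementary U (fun x => f x ^+ k).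
Proof.
move=> hf; elim: k => [|k ih].
  by under eq_fun do rewrite expr0; exact: elementary_cst.
by under eq_fun do rewrite exprS; exact: elementary_mul.
Qed.

Lemma elementary_sum U k (F : 'I_k -> 'rV[R]_n -> R) :
  (forall i, elementary U (F i)) -> elementary U (fun x => \sum_(i < k) F i x).
Proof.
move=> hF; elim: k F hF => [|k ih] F hF.
  by under eq_fun do rewrite big_ord0; exact: elementary_cst.
under eq_fun do rewrite big_ord_recl.
by apply: elementary_add => //; exact: ih.
Qed.

Lemma elementary_continuous U f : elementary U f ->
  forall x, U x -> {for x, continuous f}.
Proof.
elim=> {f} [c|j|f g _ hf _ hg|f g _ hf _ hg|f _ hf f0|f _ hf f0] x Ux.
- exact: cst_continuous.
- exact: coord_continuous.
- exact: cvgD (hf x Ux) (hg x Ux).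
- exact: cvgM (hf x Ux) (hg x Ux).
- exact: cvgV (f0 x Ux) (hf x Ux).
- apply: (@continuous_comp _ _ _ f (@ln R)); first exact: hf.
  by apply: continuous_ln; exact: f0.
Qed.

(** Symbolic differentiation. The derivative is returned as a function [g] that
    is again elementary, rather than as [partial i f], because the latter is
    only known to be elementary up to its values outside [U]. *)
Lemma elementary_partial U f (i : 'I_n) : elementary U f ->
  exists2 g, elementary U g &
    forall x, U x -> is_derive x (delta_mx 0 i) f (g x).
Proof.
elim=> {f} [c|j|f g hf [df edf hdf] hg [dg edg hdg]
  |f g hf [df edf hdf] hg [dg edg hdg]|f hf [df edf hdf] f0|f hf [df edf hdf] f0].
- by exists (fun=> 0) => [|x _]; [exact: elementary_cst|exact: is_derive_cst].
- exists (fun=> (j == i)%:R) => [|x _]; first exact: elementary_cst.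
  exact: is_derive_coord.
- exists (fun x => df x + dg x); first exact: elementary_add.
  by move=> x Ux; apply: is_derive_add; [exact: hdf|exact: hdg].
- exists (fun x => df x * g x + f x * dg x).
    by apply: elementary_add; exact: elementary_mul.
  by move=> x Ux; apply: is_derive_mul; [exact: hdf|exact: hdg].
- exists (fun x => - df x * (f x)^-1 ^+ 2).
    apply: elementary_mul; first exact: elementary_opp.
    by apply: elementary_exp; exact: elementary_inv.
  by move=> x Ux; apply: is_derive_inv; [exact: f0|exact: hdf].
- exists (fun x => df x * (f x)^-1).
    apply: elementary_mul => //; apply: elementary_inv => // x Ux.
    by rewrite gt_eqF// f0.
  by move=> x Ux; apply: is_derive_ln; [exact: f0|exact: hdf].
Qed.

Lemma partial_congr U f g (i : 'I_n) x : open U -> U x ->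
  (forall y, U y -> f y = g y) -> partial i f x = partial i g x.
Proof.
move=> oU Ux fg; apply: near_eq_derive.
by near=> y; apply: fg; near: y; exact: open_nbhs_nbhs.
Unshelve. all: by end_near. Qed.

(** Openness of [U] is what allows the agreement on [U] to survive the next
    differentiation. *)
Lemma elementary_iter_partial U f s : open U -> elementary U f ->
  exists2 g, elementary U g & forall x, U x -> iter_partial s f x = g x.
Proof.
move=> oU ef; elim: s => [|i s [g eg hg]]; first by exists f.
have [h eh hh] := elementary_partial i eg; exists h => // x Ux.
rewrite [iter_partial _ _]/= (partial_congr i oU Ux hg).
by rewrite /partial; have [_] := hh _ Ux.
Qed.

Lemma elementary_smooth U A f : open U -> A `<=` U -> elementary U f ->
  smooth_on A f.
Proof.
move=> oU AU ef; exists U; split => // s x Ux.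
have [g eg fg] := elementary_iter_partial s oU ef.
have gf : \forall y \near x, g y = iter_partial s f y.
  by near=> y; apply/esym/fg; near: y; exact: open_nbhs_nbhs.
split.
  have cg : g y @[y --> x] --> g x := elementary_continuous eg Ux.
  suff : iter_partial s f y @[y --> x] --> iter_partial s f x by [].
  rewrite (fg _ Ux); apply: cvg_trans cg.
  exact: (near_eq_cvg gf).
move=> i; apply: near_eq_derivable gf _.
by have [h _ /(_ _ Ux) hh] := elementary_partial i eg; apply: ex_derive.
Unshelve. all: by end_near. Qed.

End Elementary.

(** * Null forms are multiples of the Minkowski form *)

Section NullForms.
Context {R : realType}.

Definition minkowski (xi : 'rV[R]_4) : R :=
  - xi 0 time_idx ^+ 2 + \sum_(i < 3) xi 0 (space_idx i) ^+ 2.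

(** Nine null vectors determine the symmetric part of [Q] up to a factor. The vectors
    e_0 + e_i and e_0 - e_i give Q_ii = - Q_00 and kill the mixed terms of
    (0,i); the Pythagorean triple (5,3,4) gives the null vector
    5 e_0 + 3 e_i + 4 e_j, which kills those of (i,j) without square roots. *)
Lemma null_form_minkowski (Q : 'M[R]_4) : null_form Q ->
  exists c, forall xi, qform Q xi xi = c * minkowski xi.
Proof.
move=> hQ.
pose vec (a b c d : R) : 'rV[R]_4 := \row_i [:: a; b; c; d]`_i.
have minkE a b c d :
    minkowski (vec a b c d) = - a ^+ 2 + (b ^+ 2 + c ^+ 2 + d ^+ 2).
  by rewrite /minkowski !big_ord_recl big_ord0 !mxE /= addr0 !addrA.
pose o : 'I_4 := ord0.
pose i1 : 'I_4 := lift ord0 ord0.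
pose i2 : 'I_4 := lift ord0 (lift ord0 ord0).
pose i3 : 'I_4 := lift ord0 (lift ord0 (lift ord0 ord0)).
have qE a b c d : qform Q (vec a b c d) (vec a b c d) =
    Q o o * a ^+ 2 + Q i1 i1 * b ^+ 2 + Q i2 i2 * c ^+ 2 + Q i3 i3 * d ^+ 2
    + (Q o i1 + Q i1 o) * a * b + (Q o i2 + Q i2 o) * a * c
    + (Q o i3 + Q i3 o) * a * d + (Q i1 i2 + Q i2 i1) * b * c
    + (Q i1 i3 + Q i3 i1) * b * d + (Q i2 i3 + Q i3 i2) * c * d.
  rewrite /qform !big_ord_recl !big_ord0 !mxE /=.
  rewrite -/o -/i1 -/i2 -/i3; ring.
have test a b c d : a ^+ 2 = b ^+ 2 + c ^+ 2 + d ^+ 2 ->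
    qform Q (vec a b c d) (vec a b c d) = 0.
  by move=> h; apply: hQ; rewrite /null_vector -/(minkowski _) minkE h addNr.
exists (- Q o o) => xi.
have -> : xi = vec (xi 0 o) (xi 0 i1) (xi 0 i2) (xi 0 i3).
  apply/rowP => j; rewrite mxE.
  by case: j => [[|[|[|[|//]]]] ?] /=; congr (xi _ _); apply/val_inj.
rewrite minkE qE.
have := (test 1 1 0 0, test 1 (-1) 0 0, test 1 0 1 0, test 1 0 (-1) 0,
  test 1 0 0 1, test 1 0 0 (-1)).
have := (test 5 3 4 0, test 5 3 0 4, test 5 0 3 4).
rewrite !qE => -[[t12 t13] t23] [[[[[t1 t1'] t2] t2'] t3] t3'].
move: t1 t1' t2 t2' t3 t3' t12 t13 t23.
do 9! (move=> /(_ ltac:(ring)) ?).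
have e1 : Q o i1 + Q i1 o = 0 by lra.
have e2 : Q o i2 + Q i2 o = 0 by lra.
have e3 : Q o i3 + Q i3 o = 0 by lra.
have q1 : Q i1 i1 = - Q o o by lra.
have q2 : Q i2 i2 = - Q o o by lra.
have q3 : Q i3 i3 = - Q o o by lra.
have e12 : Q i1 i2 + Q i2 i1 = 0 by lra.
have e13 : Q i1 i3 + Q i3 i1 = 0 by lra.
have e23 : Q i2 i3 + Q i3 i2 = 0 by lra.
rewrite e1 e2 e3 e12 e13 e23 q1 q2 q3; ring.
Qed.

End NullForms.

(** * The logarithmic substitution *)

Section Nirenberg.
Context {R : realType}.
Implicit Types (u : 'rV[R]_4 -> R).

Lemma elementary_is_derive n (U : set 'rV[R]_n) f s (i : 'I_n) x :
  open U -> elementary U f -> U x ->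
  is_derive x (delta_mx 0 i) (iter_partial s f) (iter_partial (i :: s) f x).
Proof.
move=> oU ef Ux; apply/derivableP.
have [W [_ UW sm]] : smooth_on U f by exact: elementary_smooth oU _ ef.
by have [_] := sm s x (UW _ Ux); apply.
Qed.

(** The identity behind the substitution, with [y], [p], [q] standing for u and
    its first and pure second derivatives, and [g], [h] for those of - ln u / c:
    the quadratic terms produced by the logarithm are exactly the nonlinearity,
    and the linear ones cancel by the wave equation. *)
Lemma log_gradient_algebra (c y : R) (p q g h : 'I_4 -> R) :
  c != 0 -> y != 0 ->
  (forall a, g a = - c^-1 * (p a * y^-1)) ->
  (forall a, h a = - c^-1 * (q a * y^-1 - (p a * y^-1) ^+ 2)) ->
  - q time_idx + \sum_(i < 3) q (space_idx i) = 0 ->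
  - h time_idx + \sum_(i < 3) h (space_idx i) =
    c * (- g time_idx ^+ 2 + \sum_(i < 3) g (space_idx i) ^+ 2).
Proof.
move=> c0 y0 gE hE; rewrite !big_ord_recl !big_ord0 !gE !hE.
move=> /eqP; rewrite addrC addr_eq0 opprK => /eqP <-.
by field; rewrite c0 y0.
Qed.

Lemma box_log (U : set 'rV[R]_4) u c X : open U -> elementary U u ->
  (forall Y, U Y -> 0 < u Y) -> c != 0 -> U X -> box u X = 0 ->
  box (fun Y => - c^-1 * ln (u Y)) X
  = c * minkowski (grad (fun Y => - c^-1 * ln (u Y)) X).
Proof.
move=> oU eu u0 c0 UX; set phi := fun Y => _.
have d1 a Y : U Y -> partial a phi Y = - c^-1 * (partial a u Y * (u Y)^-1).
  move=> UY; have du := elementary_is_derive [::] a oU eu UY.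
  have [_ E] := is_derive_mul (is_derive_const (- c^-1) Y (delta_mx 0 a))
    (is_derive_ln (u0 _ UY) du).
  by rewrite [LHS]E mul0r add0r.
have d2 a : partial a (partial a phi) X = - c^-1 *
    (partial a (partial a u) X * (u X)^-1 - (partial a u X * (u X)^-1) ^+ 2).
  have un0 : u X != 0 by rewrite gt_eqF// u0.
  rewrite (partial_congr a oU UX (d1 a)).
  have [_ E] := is_derive_mul (is_derive_const (- c^-1) X (delta_mx 0 a))
    (is_derive_mul (elementary_is_derive [:: a] a oU eu UX)
      (is_derive_inv un0 (elementary_is_derive [::] a oU eu UX))).
  rewrite [LHS]E /=; ring.
have un0 : u X != 0 by rewrite gt_eqF// u0.
have gE a : grad phi X 0 a = - c^-1 * (partial a u X * (u X)^-1).
  by rewrite mxE d1.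
exact: (log_gradient_algebra c0 un0 gE d2).
Qed.

End Nirenberg.

(** * A solution of the linear wave equation with the sign of t *)

Section ExplicitWave.
Context {R : realType}.
Implicit Types X : 'rV[R]_4.

Definition radius2 X : R := \sum_(i < 3) X 0 (space_idx i) ^+ 2.
(** The real part and, next, the squared modulus of
    r^2 - (t - i)^2 = (r^2 - t^2 + 1) + 2 i t. *)
Definition cone_re X : R := radius2 X - X 0 time_idx ^+ 2 + 1.
Definition cone_norm2 X : R := cone_re X ^+ 2 + 4 * X 0 time_idx ^+ 2.
(** This is -1/2 times the imaginary part of 1 / (r^2 - (t - i)^2). *)
Definition wave X : R := X 0 time_idx * (cone_norm2 X)^-1.

Lemma radius2_ge0 X : 0 <= radius2 X.
Proof. by apply: sumr_ge0 => i _; exact: sqr_ge0. Qed.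

Lemma cone_norm2_gt0 X : 0 < cone_norm2 X.
Proof.
rewrite /cone_norm2 /cone_re; have := radius2_ge0 X.
have [-> r0|t0 r0] := eqVneq (X 0 time_idx) 0; first by nra.
have : 0 < X 0 time_idx ^+ 2 by rewrite exprn_even_gt0.
by have := sqr_ge0 (radius2 X - X 0 time_idx ^+ 2 + 1); lra.
Qed.

Lemma cone_norm2_neq0 X : cone_norm2 X != 0.
Proof. by rewrite gt_eqF// cone_norm2_gt0. Qed.

Lemma elementary_wave U : elementary U wave.
Proof.
have et : elementary U (fun X => X 0 time_idx) by exact: elementary_coord.
have eD : elementary U cone_norm2.
  apply: elementary_add; last first.
    by apply: elementary_mul; [exact: elementary_cst|exact: elementary_exp].
  apply: elementary_exp; apply: elementary_add; last exact: elementary_cst.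
  apply: elementary_add; last by apply: elementary_opp; exact: elementary_exp.
  by apply: elementary_sum => i; apply: elementary_exp; exact: elementary_coord.
apply: elementary_mul => //; apply: elementary_inv => // X _.
exact: cone_norm2_neq0.
Qed.

Lemma time_derivative_coords X :
  is_derive X (delta_mx 0 time_idx) (fun Y => Y 0 time_idx) 1 /\
  is_derive X (delta_mx 0 time_idx) radius2 0.
Proof.
split; first exact: is_derive_coord.
rewrite /radius2; under eq_fun do rewrite !big_ord_recl big_ord0.
have d (i : 'I_3) :
    is_derive X (delta_mx 0 time_idx) (fun Y => Y 0 (space_idx i) ^+ 2) 0.
  under eq_fun do rewrite expr2.
  apply: is_derive_eq (is_derive_mul (is_derive_coord _ _ _)
    (is_derive_coord _ _ _)) _.
  by rewrite mul0r mulr0 addr0.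
apply: is_derive_eq (is_derive_add (d _) (is_derive_add (d _)
  (is_derive_add (d _) (is_derive_const 0 _ _)))) _.
by rewrite !addr0.
Qed.

Lemma space_derivative_coords i X :
  is_derive X (delta_mx 0 (space_idx i)) (fun Y => Y 0 time_idx) 0 /\
  is_derive X (delta_mx 0 (space_idx i)) radius2 (2 * X 0 (space_idx i)).
Proof.
split; first exact: is_derive_coord.
rewrite /radius2; under eq_fun do rewrite !big_ord_recl big_ord0.
have d (j : 'I_3) :
    is_derive X (delta_mx 0 (space_idx i)) (fun Y => Y 0 (space_idx j) ^+ 2)
      ((j == i)%:R * (2 * X 0 (space_idx j))).
  under eq_fun do rewrite expr2.
  apply: is_derive_eq (is_derive_mul (is_derive_coord _ _ _)
    (is_derive_coord _ _ _)) _.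
  by rewrite (_ : (space_idx j == space_idx i) = (j == i))//; ring.
apply: is_derive_eq (is_derive_add (d _) (is_derive_add (d _)
  (is_derive_add (d _) (is_derive_const 0 _ _)))) _.
have -> : X 0 (space_idx i) = \sum_(j < 3) (j == i)%:R * X 0 (space_idx j).
  rewrite (bigD1 i)//= eqxx mul1r big1 ?addr0// => j /negbTE ->.
  by rewrite mul0r.
rewrite !big_ord_recl big_ord0; ring.
Qed.

(** Time and space directions are treated at once: [dt] and [dr] are the
    derivatives of t and r^2 along [v]. *)
Lemma is_derive_cone v X (dt dr : R) :
  is_derive X v (fun Y => Y 0 time_idx) dt -> is_derive X v radius2 dr ->
  is_derive X v cone_re (dr - 2 * X 0 time_idx * dt) /\
  is_derive X v cone_norm2 (2 * cone_re X * (dr - 2 * X 0 time_idx * dt)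
    + 8 * X 0 time_idx * dt).
Proof.
move=> ht hr.
have hs : is_derive X v cone_re (dr - 2 * X 0 time_idx * dt).
  rewrite /cone_re; under eq_fun do rewrite -mulN1r expr2.
  apply: is_derive_eq (is_derive_add (is_derive_add hr (is_derive_mul
    (is_derive_const (-1) _ _) (is_derive_mul ht ht))) (is_derive_const 1 _ _)) _.
  ring.
split => //; rewrite /cone_norm2; under eq_fun do rewrite !expr2.
apply: is_derive_eq (is_derive_add (is_derive_mul hs hs)
  (is_derive_mul (is_derive_const 4 _ _) (is_derive_mul ht ht))) _.
ring.
Qed.

Lemma partial_time_wave : partial time_idx wave = fun X =>
  (cone_norm2 X)^-1 +
  X 0 time_idx ^+ 2 * (4 * cone_re X - 8) * (cone_norm2 X)^-1 ^+ 2.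
Proof.
apply/funext => X; have [ht hr] := time_derivative_coords X.
have [hs hD] := is_derive_cone ht hr.
have [_ E] := is_derive_mul ht (is_derive_inv (cone_norm2_neq0 X) hD).
rewrite [LHS]E; ring.
Qed.

Lemma partial_space_wave i : partial (space_idx i) wave = fun X =>
  - 4 * X 0 time_idx * cone_re X * X 0 (space_idx i)
  * (cone_norm2 X)^-1 ^+ 2.
Proof.
apply/funext => X; have [ht hr] := space_derivative_coords i X.
have [hs hD] := is_derive_cone ht hr.
have [_ E] := is_derive_mul ht (is_derive_inv (cone_norm2_neq0 X) hD).
rewrite [LHS]E; ring.
Qed.

(** With s = r^2 - t^2 + 1 and D = s^2 + 4 t^2, the terms of box wave in D^-2
    add up to 32 t (1 - s) / D^2. Those in D^-3 add up to
    32 t (s - 1) (s^2 + 4 t^2) / D^3, in which the last factor is D. *)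
Lemma box_wave X : box wave X = 0.
Proof.
have D0 := cone_norm2_neq0 X.
pose t := X 0 time_idx; pose s := cone_re X; pose iD := (cone_norm2 X)^-1.
have tt : partial time_idx (partial time_idx wave) X =
    (4 * s * t - 8 * t) * iD ^+ 2 + (2 * t * (4 * s - 8) - 8 * t ^+ 3) * iD ^+ 2
    + 2 * t ^+ 3 * (4 * s - 8) ^+ 2 * iD ^+ 3.
  rewrite partial_time_wave; have [ht hr] := time_derivative_coords X.
  have [hs hD] := is_derive_cone ht hr.
  have hi := is_derive_inv D0 hD.
  under eq_fun do rewrite !expr2.
  have [_ E] := is_derive_add hi (is_derive_mul (is_derive_mul
    (is_derive_mul ht ht) (is_derive_add (is_derive_mul (is_derive_const 4 _ _) hs)
    (is_derive_const (-8) _ _))) (is_derive_mul hi hi)).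
  rewrite [LHS]E -/t -/s -/iD; ring.
have xx i : partial (space_idx i) (partial (space_idx i) wave) X =
    - 8 * t * X 0 (space_idx i) ^+ 2 * iD ^+ 2 - 4 * t * s * iD ^+ 2
    + 32 * t * s ^+ 2 * X 0 (space_idx i) ^+ 2 * iD ^+ 3.
  rewrite partial_space_wave; have [ht hr] := space_derivative_coords i X.
  have [hs hD] := is_derive_cone ht hr.
  have hi := is_derive_inv D0 hD.
  under eq_fun do rewrite !expr2.
  have [_ E] := is_derive_mul (is_derive_mul (is_derive_mul (is_derive_mul
    (is_derive_const (- 4) _ _) ht) hs) (is_derive_coord (space_idx i) (space_idx i) X))
    (is_derive_mul hi hi).
  have e1 : (space_idx i == space_idx i)%:R = 1 :> R by rewrite eqxx.
  rewrite [LHS]E e1 -/t -/s -/iD; ring.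
have rE : radius2 X = s + t ^+ 2 - 1 by rewrite /s /cone_re -/t; ring.
have iDE : iD = (s ^+ 2 + 4 * t ^+ 2)^-1 by [].
have sum_xx : \sum_(i < 3) partial (space_idx i) (partial (space_idx i) wave) X =
    (- 8 * t * iD ^+ 2 + 32 * t * s ^+ 2 * iD ^+ 3) * radius2 X
    - 12 * t * s * iD ^+ 2.
  rewrite (eq_bigr _ (fun i _ => xx i)) /radius2 !big_ord_recl !big_ord0; ring.
by rewrite /box tt sum_xx rE iDE; field; exact: D0.
Qed.

End ExplicitWave.

(** * The energy of the initial data *)

Section Energy.
Context {R : realType}.
Local Notation leb := (@lebesgue_measure R).

(** Canonical inference on a product measure selects structures meant for
    products of subprobabilities; to iterate Tonelli the sigma-finite structure
    of [m1 \x m2] has to be named. *)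
Definition product_sigma_finite d1 d2 (T1 : measurableType d1)
    (T2 : measurableType d2) (m1 : {sigma_finite_measure set T1 -> \bar R})
    (m2 : {sigma_finite_measure set T2 -> \bar R}) :
    {sigma_finite_measure set (T1 * T2)%type -> \bar R} :=
  HB.pack (m1 \x m2)%E
    (lebesgue_integral_fubini.measure_function_Measure_isSigmaFinite__to__measure_function_isSFinite m1 m2)
    (lebesgue_integral_fubini.measure_function_Measure_isSigmaFinite__to__measure_function_isSigmaFinite m1 m2).

Lemma ge0_integral_prod d1 d2 (T1 : measurableType d1) (T2 : measurableType d2)
    (m1 : {sigma_finite_measure set T1 -> \bar R})
    (m2 : {sigma_finite_measure set T2 -> \bar R})
    (f : T1 -> R) (g : T2 -> R) :
  measurable_fun setT f -> measurable_fun setT g ->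
  (forall x, 0 <= f x) -> (forall y, 0 <= g y) ->
  (\int[m1 \x m2]_z (f z.1 * g z.2)%:E =
   \int[m1]_x (f x)%:E * \int[m2]_y (g y)%:E)%E.
Proof.
move=> mf mg f0 g0; rewrite fubini_tonelli1.
- rewrite /fubini_F -ge0_integralZr//.
  + apply: eq_integral => x _ /=.
    under eq_integral do rewrite EFinM.
    rewrite ge0_integralZl//.
    * exact/measurable_EFinP.
    * by move=> y _; rewrite lee_fin.
    * by rewrite lee_fin.
  + exact/measurable_EFinP.
  + by move=> x _; rewrite lee_fin.
  + by apply: integral_ge0 => y _; rewrite lee_fin.
- apply/measurable_EFinP; apply: measurable_funM.
    exact: measurableT_comp.
  exact: measurableT_comp.
- by move=> z; rewrite lee_fin mulr_ge0.
Qed.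

Lemma integral_inv_oneDsqr_lty : (\int[leb]_x (oneDsqr x)^-1%:E < +oo)%E.
Proof.
rewrite (@ge0_symfun_integralT _ (fun x : R => (oneDsqr x)^-1)).
- by rewrite -set_itvcy integral0y_oneDsqr -EFinM ltry.
- by move=> x; rewrite invr_ge0 (le_trans ler01)// oneDsqr_ge1.
- exact: continuous_oneDsqrV.
- by move=> x; rewrite /= /oneDsqr sqrrN.
Qed.

Definition bump (k : R) (x : 'rV[R]_3) : R :=
  k * (1 + \sum_(i < 3) x 0 i ^+ 2)^-1 ^+ 2.

Lemma elementary_bump U k : elementary U (bump k).
Proof.
apply: elementary_mul; first exact: elementary_cst.
apply: elementary_exp; apply: elementary_inv => [|x _].
  apply: elementary_add; first exact: elementary_cst.
  by apply: elementary_sum => i; apply: elementary_exp; exact: elementary_coord.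
by rewrite gt_eqF// ltr_wpDr// sumr_ge0// => i _; exact: sqr_ge0.
Qed.

Let density (p : R * R * R) : R :=
  (1 + (p.1.1 ^+ 2 + p.1.2 ^+ 2 + p.2 ^+ 2))^-1 ^+ 4.

Let density_ge0 p : 0 <= density p.
Proof. by rewrite exprn_ge0// invr_ge0 !addr_ge0// sqr_ge0. Qed.

Let measurable_density : measurable_fun setT density.
Proof.
have inv_continuous : continuous (fun y : R => (1 + `|y|)^-1).
  move=> y; apply: cvgV; first by rewrite gt_eqF// ltr_wpDr.
  by apply: cvgD; [exact: cvg_cst|exact: norm_continuous].
(* The absolute value makes the inverse continuous on the whole line. *)
have -> : density = (fun p => (1 + `|p.1.1 ^+ 2 + p.1.2 ^+ 2 + p.2 ^+ 2|)^-1 ^+ 4).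
  by apply/funext => p; rewrite /density ger0_norm// !addr_ge0// sqr_ge0.
apply: measurable_funX.
apply: (measurableT_comp (continuous_measurable_fun inv_continuous)).
apply: measurable_funD; last exact: measurable_funX.
apply: measurable_funD; apply: measurable_funX.
  by apply: (measurableT_comp measurable_fst); exact: measurable_fst.
by apply: (measurableT_comp measurable_snd); exact: measurable_fst.
Qed.

Let energy_bumpE k : energy (fun=> 0%R) (bump k) =
  ((2^-1 * k ^+ 2)%:E * \int[(leb \x leb) \x leb]_p (density p)%:E)%E.
Proof.
rewrite /energy EFinM -muleA; congr (_ * _)%E.
rewrite -ge0_integralZl//; last 3 first.
- exact/measurable_EFinP.
- by move=> p _; rewrite lee_fin.
- by rewrite lee_fin sqr_ge0.
apply: eq_integral => p _; rewrite -EFinM; congr EFin.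
rewrite /energy_density big1 => [|i _]; last first.
  by rewrite /partial derive_cst expr0n.
rewrite add0r /bump exprMn -exprM /density; congr (_ * (1 + _)^-1 ^+ 4).
by rewrite !big_ord_recl big_ord0 !mxE /= addr0 addrA.
Qed.

(** The density is at most k^2 times the product of the 1 / (1 + x_i^2), whose
    integral over the space is pi^3. *)
Lemma energy_bump_lty k : (energy (fun=> 0%R) (bump k) < +oo)%E.
Proof.
rewrite energy_bumpE; apply: lte_mul_pinfty => //.
  by rewrite lee_fin mulr_ge0// sqr_ge0.
pose g (x : R) := (oneDsqr x)^-1.
have g0 x : 0 <= g x by rewrite invr_ge0 (le_trans ler01)// oneDsqr_ge1.
have mg : measurable_fun setT g.
  by apply: continuous_measurable_fun; exact: continuous_oneDsqrV.
have mgg : measurable_fun setT (fun q : R * R => g q.1 * g q.2).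
  by apply: measurable_funM; exact: measurableT_comp.
have gg0 (q : R * R) : 0 <= g q.1 * g q.2 by rewrite mulr_ge0.
apply: (@le_lt_trans _ _
  (\int[(leb \x leb) \x leb]_p (g p.1.1 * g p.1.2 * g p.2)%:E)%E).
  apply: ge0_le_integral => //.
  - by move=> p _; rewrite lee_fin.
  - exact/measurable_EFinP.
  - apply/measurable_EFinP; apply: measurable_funM.
      exact: (measurableT_comp mgg measurable_fst).
    exact: (measurableT_comp mg measurable_snd).
  move=> p _; rewrite lee_fin /density /g /oneDsqr.
  have [a0 b0 c0] := And3 (sqr_ge0 p.1.1) (sqr_ge0 p.1.2) (sqr_ge0 p.2).
  move: (p.1.1 ^+ 2) (p.1.2 ^+ 2) (p.2 ^+ 2) a0 b0 c0 => a b c a0 b0 c0.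
  rewrite -!invfM exprVn lef_pV2 ?posrE; last 2 first.
  - by rewrite exprn_gt0//; lra.
  - by rewrite !mulr_gt0//; lra.
  rewrite (exprSr _ 3) -[leLHS]mulr1.
  apply: ler_pM; [by rewrite !mulr_ge0//; lra|exact: ler01| |lra].
  by rewrite !exprSr expr0 mul1r !ler_pM// ?mulr_ge0//; lra.
have -> : (\int[(leb \x leb) \x leb]_p (g p.1.1 * g p.1.2 * g p.2)%:E =
    \int[leb \x leb]_q (g q.1 * g q.2)%:E * \int[leb]_x (g x)%:E)%E :=
  ge0_integral_prod (product_sigma_finite leb leb) leb mgg mg gg0 g0.
have -> : (\int[leb \x leb]_q (g q.1 * g q.2)%:E =
    \int[leb]_x (g x)%:E * \int[leb]_x (g x)%:E)%E :=
  ge0_integral_prod leb leb mg mg g0 g0.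
have fin : (\int[leb]_x (g x)%:E \is a fin_num)%E.
  rewrite ge0_fin_numE; first exact: integral_inv_oneDsqr_lty.
  by apply: integral_ge0 => x _; rewrite lee_fin.
by rewrite -(fineK fin) -!EFinM ltry.
Qed.

(** On the unit cube r^2 <= 3, so the density is at least k^2 / 4^4 there. *)
Lemma energy_bump_ge k : ((2^-1 * k ^+ 2 * 4^-1 ^+ 4)%:E <= energy (fun=> 0%R) (bump k))%E.
Proof.
rewrite energy_bumpE EFinM; apply: lee_wpmul2l; first by rewrite lee_fin mulr_ge0// sqr_ge0.
pose I : set R := `[0, 1]%classic.
have mI : measurable I by exact: measurable_itv.
pose C : set (R * R * R) := I `*` I `*` I.
have mC : measurable C by apply: measurableX => //; exact: measurableX.
have leb_I : leb I = 1%E.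
  by rewrite lebesgue_measure_itv/= lte_fin ltr01 oppr0 adde0.
have measC : ((leb \x leb) \x leb)%E C = 1%E.
  have mI2 : measurable (I `*` I) by exact: measurableX.
  have E3 : ((leb \x leb) \x leb)%E C = ((leb \x leb)%E (I `*` I) * leb I)%E.
    exact: product_measure1E.
  have E2 : (leb \x leb)%E (I `*` I) = (leb I * leb I)%E.
    exact: product_measure1E.
  by rewrite E3 E2 leb_I !mule1.
have cube : (\int[(leb \x leb) \x leb]_(p in C) (density p)%:E <=
    \int[(leb \x leb) \x leb]_p (density p)%:E)%E.
  apply: ge0_subset_integral => //; first exact/measurable_EFinP.
  by move=> p _; rewrite lee_fin.
apply: le_trans cube.
have -> : (4^-1 ^+ 4)%:E = (\int[(leb \x leb) \x leb]_(p in C) (4^-1 ^+ 4)%:E)%E.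
  by rewrite integral_cst// [X in (_ * X)%E]measC mule1.
apply: ge0_le_integral; first exact: mC.
- by move=> p _; rewrite lee_fin exprn_ge0// invr_ge0.
- exact: measurable_cst.
- by apply/measurable_EFinP; exact: measurable_funTS.
move=> p [[/= p1 p2] p3]; rewrite lee_fin /density.
have sq_le1 (x : R) : I x -> x ^+ 2 <= 1.
  by rewrite /I /= in_itv/= => /andP[x0 x1]; rewrite expr_le1.
have [a0 b0 c0] := And3 (sqr_ge0 p.1.1) (sqr_ge0 p.1.2) (sqr_ge0 p.2).
have [a1 b1 c1] := And3 (sq_le1 _ p1) (sq_le1 _ p2) (sq_le1 _ p3).
rewrite lerXn2r// ?nnegrE ?invr_ge0//; first by lra.
by rewrite lef_pV2 ?posrE; lra.
Qed.

End Energy.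

(** * Global solutions with prescribed initial velocity *)

Section GlobalSolutions.
Context {R : realType}.

Lemma event_time (t : R) x : event t x 0 time_idx = t.
Proof.
have -> : time_idx = lshift 3 (ord0 : 'I_1) by exact/val_inj.
transitivity ((t%:M : 'M[R]_1) 0 ord0); first exact: row_mxEl.
by rewrite mxE eqxx mulr1n.
Qed.

Lemma event_space (t : R) x i : event t x 0 (space_idx i) = x 0 i.
Proof. exact: row_mxEr. Qed.

(** One family serves both cases: b = 0 is the solution itself when the
    equation is linear, b = 1 is the positive function u otherwise. *)
Definition affine_wave (b k : R) X : R := b + k * wave X.

Lemma elementary_affine_wave U b k : elementary U (affine_wave b k).
Proof.
apply: elementary_add; first exact: elementary_cst.
by apply: elementary_mul; [exact: elementary_cst|exact: elementary_wave].
Qed.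

Lemma partial_affine_wave b k a :
  partial a (affine_wave b k) = fun X => k * partial a wave X.
Proof.
apply/funext => X.
have dw := elementary_is_derive [::] a openT (elementary_wave setT) (I : setT X).
have [_ E] := is_derive_add (is_derive_const b X (delta_mx 0 a))
  (is_derive_mul (is_derive_const k X (delta_mx 0 a)) dw).
by rewrite [LHS]E mul0r !add0r.
Qed.

Lemma box_affine_wave b k X : box (affine_wave b k) X = 0.
Proof.
have d2 a : partial a (partial a (affine_wave b k)) X
    = k * partial a (partial a wave) X.
  have dw := elementary_is_derive [:: a] a openT (elementary_wave setT)
    (I : setT X).
  have [_ E] := is_derive_mul (is_derive_const k X (delta_mx 0 a)) dw.
  by rewrite partial_affine_wave [LHS]E mul0r add0r.
rewrite /box d2 (eq_bigr _ (fun i _ => d2 (space_idx i))).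
by rewrite -mulr_sumr -mulrN -mulrDr -/(box wave X) box_wave mulr0.
Qed.

Lemma affine_wave_initial b k x : affine_wave b k (event 0 x) = b.
Proof. by rewrite /affine_wave /wave event_time mul0r mulr0 addr0. Qed.

Lemma partial_time_affine_wave_initial b k x :
  partial time_idx (affine_wave b k) (event 0 x) = bump k x.
Proof.
rewrite partial_affine_wave partial_time_wave event_time expr0n mul0r mul0r addr0.
rewrite /bump exprVn /cone_norm2 /cone_re event_time expr0n /=.
rewrite mulr0 addr0 subr0 addrC; congr (_ * ((1 + _) ^+ 2)^-1).
by apply: eq_bigr => i _; rewrite event_space.
Qed.

Lemma linear_global_solution (Q : 'M[R]_4) k :
  (forall xi, qform Q xi xi = 0) ->
  classical_solution Q (fun=> 0) (bump k) `[0, +oo[ (affine_wave 0 k).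
Proof.
move=> Q0; split.
- by apply: (elementary_smooth openT) => //; exact: elementary_affine_wave.
- by move=> X _; rewrite Q0 box_affine_wave.
- by move=> x; rewrite affine_wave_initial.
- by move=> x; rewrite partial_time_affine_wave_initial.
Qed.

(** The solution is smooth on the open set where u > 0, which contains the
    half-space t >= 0 because u >= 1 there. *)
Lemma nonlinear_global_solution (Q : 'M[R]_4) c k : c != 0 -> 0 <= k ->
  (forall xi, qform Q xi xi = c * minkowski xi) ->
  classical_solution Q (fun=> 0) (bump (- c^-1 * k)) `[0, +oo[
    (fun X => - c^-1 * ln (affine_wave 1 k X)).
Proof.
move=> c0 k0 hQ; pose u := affine_wave 1 k.
have eu U : elementary U u := elementary_affine_wave U 1 k.
pose U := [set X | 0 < u X].
have oU : open U.
  apply: (@open_comp _ _ u [set y | 0 < y]); last exact: open_gt.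
  by move=> X _; exact: (elementary_continuous (eu setT)).
have slabU : time_slab `[0, +oo[ `<=` U.
  move=> X; rewrite /time_slab /= in_itv/= andbT => t0.
  by rewrite /U /= ltr_wpDr// !mulr_ge0// invr_ge0 ltW// cone_norm2_gt0.
split.
- apply: (elementary_smooth oU) => //.
  by apply: elementary_mul; [exact: elementary_cst|exact: elementary_ln].
- move=> X /slabU UX; rewrite hQ.
  by apply: (box_log oU (eu U)) => //; exact: box_affine_wave.
- by move=> x; rewrite affine_wave_initial ln1 mulr0.
- move=> x; have ux : u (event 0 x) = 1 by exact: affine_wave_initial.
  have u0 : 0 < u (event 0 x) by rewrite ux.
  have du := elementary_is_derive [::] time_idx openT (eu setT)
    (I : setT (event 0 x)).
  have [_ E] := is_derive_mul (is_derive_const (- c^-1) _ (delta_mx 0 time_idx))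
    (is_derive_ln u0 du).
  rewrite [LHS]E mul0r add0r ux invr1 mulr1.
  by rewrite [iter_partial _ _ _]partial_time_affine_wave_initial /bump mulrA.
Qed.

End GlobalSolutions.

Theorem theorem1 (R : realType) (Q : 'M[R]_4) (hQ : null_form Q)
    (E0 : R) (hE0 : 0 < E0) :
  exists phi0 phi1 : 'rV[R]_3 -> R,
    [/\ smooth_on [set: 'rV[R]_3] phi0,
        smooth_on [set: 'rV[R]_3] phi1,
        (E0%:E <= energy phi0 phi1)%E,
        (energy phi0 phi1 < +oo)%E &
        exists phi : 'rV[R]_4 -> R,
          classical_solution Q phi0 phi1 `[0, +oo[ phi].
Proof.
(* The lower bound on the energy is then 2 (E0 + 1)^2. *)
pose k : R := 32 * (E0 + 1).
have [c cE] := null_form_minkowski hQ.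
suff [k' k'E [phi sol]] : exists2 k', k' ^+ 2 = k ^+ 2 &
    exists phi, classical_solution Q (fun=> 0) (bump k') `[0, +oo[ phi.
  exists (fun=> 0), (bump k'); split.
  - by apply: (elementary_smooth openT) => //; exact: elementary_cst.
  - by apply: (elementary_smooth openT) => //; exact: elementary_bump.
  - apply: le_trans (energy_bump_ge k'); rewrite k'E lee_fin.
    have -> : 2^-1 * k ^+ 2 * 4^-1 ^+ 4 = 2 * (E0 + 1) ^+ 2 :> R.
      by rewrite /k; field.
    by nra.
  - exact: energy_bump_lty.
  - by exists phi.
have [c0|c0] := eqVneq c 0.
  exists k => //; exists (affine_wave 0 k).
  by apply: linear_global_solution => xi; rewrite cE c0 mul0r.
(* Scaling by |c| cancels the factor 1/c up to sign and keeps u >= 1. *)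
exists (- c^-1 * (`|c| * k)).
  by rewrite exprMn sqrrN exprMn real_normK ?num_real// mulrA -exprMn mulVf// expr1n mul1r.
exists (fun X => - c^-1 * ln (affine_wave 1 (`|c| * k) X)).
apply: nonlinear_global_solution => //.
by rewrite mulr_ge0//; rewrite /k; lra.
Qed.
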